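(* For every $n\in\mathbb{N}$ and all $T\in\mathcal{S}^n$, $$\pi_+(T)=\min\left\{\|T+Y\|_{\infty,\infty} : Y\in\mathcal{S}_+^n\right\}$$ (in particular the minimum is attained).
   Context: Let $\mathbb{F}$ be $\mathbb{R}$ or $\mathbb{C}$. $\mathcal{S}^n$ is the real vector space of self-adjoint (symmetric or Hermitian) $n\times n$ matrices over $\mathbb{F}$ and $\mathcal{S}_+^n\subset\mathcal{S}^n$ the cone of positive semidefinite matrices. $\|A\|_{1,1}=\sum_{k,l=1}^n|A(k,l)|$ and $\|A\|_{\infty,\infty}=\max_{k,l}|A(k,l)|$. For $T\in\mathcal{S}^n$, $\pi_+(T):=\sup\{\mathrm{tr}(TA): A\in\mathcal{S}_+^n,\ \|A\|_{1,1}\le 1\}$. *)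

(* Defs.v *)
From HB Require Import structures.
From mathcomp Require Import all_boot all_order all_algebra.
From mathcomp Require Import complex.
From mathcomp Require Import boolp classical_sets reals.

Set Implicit Arguments.
Unset Strict Implicit.
Unset Printing Implicit Defensive.

Import Order.TTheory GRing.Theory Num.Theory.

Local Open Scope classical_set_scope.
Local Open Scope ring_scope.

(* Matrices over a scalar field F that is either R, with cj = idfun and
   re = idfun, or R[i], with cj the complex conjugation and re the real part.
   Norms and traces of products of self-adjoint matrices are real elements of
   F; re turns them into elements of R. *)
Section SelfAdjoint.
Variables (R : realType) (F : numFieldType) (n : nat).
Variables (cj : {rmorphism F -> F}) (re : F -> R).
Implicit Types A T : 'M[F]_n.

(* hermitianmx n false cj is the library's set of the A equal to their own
   cj-conjugate transpose. *)
Definition selfadjoint A : Prop := A \is hermitianmx n false cj.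

(* In R[i], 0 <= z means that z is real and nonnegative. *)
Definition psd A : Prop :=
  selfadjoint A /\ forall x : 'cV[F]_n, 0 <= (map_mx cj x^T *m A *m x) 0 0.

Definition norm11 A : R := \sum_(k < n) \sum_(l < n) re `|A k l|.

Definition normoo A : R :=
  \big[Num.max/0]_(k < n) \big[Num.max/0]_(l < n) re `|A k l|.

(* The set is nonempty (take A = 0) and bounded above by normoo T. *)
Definition pi_plus T : R :=
  sup [set re (\tr (T *m A)) | A in [set A | psd A /\ norm11 A <= 1]].

End SelfAdjoint.

Definition is_minimum (R : realType) (S : set R) (m : R) : Prop :=
  S m /\ lbound S m.

(* Main.v *)
(* Strong duality by projection. Let p = pi_+(T), let B be the set of
   self-adjoint Z with max-norm at most p, and let (Y0, Z0) minimize the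
   Hilbert-Schmidt norm of D = T + Y - Z over psd Y and Z in B; a minimizer
   exists because B is compact. First-order optimality, tested with
   Y = Y0 + x x^H, shows that D is psd, and, tested with Y = 0 and
   Z = p phase(D), that <D, Y0 - Z0> <= - p |D|_{1,1}. Hence
   |D|^2 = <D, T> + <D, Y0 - Z0> <= tr(T D) - p |D|_{1,1} <= 0 by definition of
   p, so that T + Y0 = Z0. The real case follows from the complex one by taking
   real parts, which preserves psd matrices and does not increase the norms. *)
Require Import Defs.
From HB Require Import structures.
From mathcomp Require Import all_boot all_order all_algebra.
From mathcomp Require Import complex.
From mathcomp Require Import boolp classical_sets reals.
From mathcomp Require Import topology normedtype derive.
From mathcomp Require Import ring lra.

Set Implicit Arguments.
Unset Strict Implicit.
Unset Printing Implicit Defensive.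

Import Order.TTheory GRing.Theory Num.Theory.
Import numFieldNormedType.Exports.

Local Open Scope classical_set_scope.
Local Open Scope ring_scope.

(** * Nearest points of two closed convex sets in Euclidean space *)

Section NearestPoint.
Variables (R : realType) (N : nat).
Implicit Types (u v t : 'rV[R]_N) (K B : set 'rV[R]_N).

Definition dotv u v : R := \sum_i u 0 i * v 0 i.

Definition convex_set K : Prop :=
  forall u v (s : R), K u -> K v -> 0 <= s <= 1 -> K (u + s *: (v - u)).

Lemma dotvDl u1 u2 v : dotv (u1 + u2) v = dotv u1 v + dotv u2 v.
Proof. by rewrite -big_split; apply: eq_bigr => i _; rewrite mxE mulrDl. Qed.

Lemma dotvC u v : dotv u v = dotv v u.
Proof. by apply: eq_bigr => i _; rewrite mulrC. Qed.

Lemma dotvDr u v1 v2 : dotv u (v1 + v2) = dotv u v1 + dotv u v2.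
Proof. by rewrite dotvC dotvDl !(dotvC u). Qed.

Lemma dotvZr u a v : dotv u (a *: v) = a * dotv u v.
Proof. by rewrite mulr_sumr; apply: eq_bigr => i _; rewrite mxE mulrCA. Qed.

Lemma dotvBr u v1 v2 : dotv u (v1 - v2) = dotv u v1 - dotv u v2.
Proof. by rewrite dotvDr -scaleN1r dotvZr mulN1r. Qed.

Lemma dotvv_ge0 u : 0 <= dotv u u.
Proof. by apply: sumr_ge0 => i _; rewrite -expr2 sqr_ge0. Qed.

Lemma sqr_le_dotvv u i : u 0 i ^+ 2 <= dotv u u.
Proof.
rewrite /dotv (bigD1 i) //= -expr2 lerDl.
by apply: sumr_ge0 => j _; rewrite -expr2 sqr_ge0.
Qed.

(** From $a \le a^2 + 1$: coordinates are bounded by the squared norm, without square roots. *)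
Lemma norm_le_dotvv u i : `|u 0 i| <= dotv u u + 1.
Proof.
have := sqr_le_dotvv u i; rewrite -(real_normK (num_real (u 0 i))).
by move: `|_| (dotv _ _) => a b; nra.
Qed.

Lemma dotvv_eq0 u : dotv u u <= 0 -> u = 0.
Proof.
move=> u0; apply/rowP => i; rewrite mxE; apply/eqP.
by rewrite -sqrf_eq0 eq_le sqr_ge0 (le_trans (sqr_le_dotvv u i)).
Qed.

(* If [<d, h> < 0], the step [s = - <d, h> / (|h|^2 - <d, h>)] shortens [d]. *)
Lemma first_order_dotv d h :
  (forall s : R, 0 <= s <= 1 -> dotv d d <= dotv (d + s *: h) (d + s *: h)) ->
  0 <= dotv d h.
Proof.
move=> dmin; rewrite leNgt; apply/negP => dh0.
have hh := dotvv_ge0 h.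
pose s := - dotv d h / (dotv h h - dotv d h).
have den : 0 < dotv h h - dotv d h by lra.
have s1 : 0 <= s <= 1.
  apply/andP; split; first by apply: divr_ge0; lra.
  by rewrite ler_pdivrMr // mul1r; lra.
have s0 : 0 < s by rewrite divr_gt0 // oppr_gt0.
have := dmin s s1.
rewrite dotvDr dotvZr !(dotvC (d + _)) !dotvDr !dotvZr (dotvC h d) => dm.
have : 0 <= s * (2 * dotv d h + s * dotv h h) by lra.
rewrite pmulr_rge0 // => le2.
(* Hence $s|h|^2 = (s-1)\langle d,h\rangle$, and the second factor in [le2] equals $(1+s)\langle
   d,h\rangle$, which is negative. *)
have sE : s * (dotv h h - dotv d h) = - dotv d h by rewrite divfK ?gt_eqF.
nra.
Qed.

Lemma coordinate_box_compact (r : R) :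
  compact [set v : 'rV[R]_N | forall i, `|v 0 i| <= r].
Proof.
have := @rV_compact R N _ (fun=> @segment_compact R (- r) r).
congr compact; apply/seteqP; split => v /= vr i; have := vr i;
  by rewrite /= in_itv /= -ler_norml.
Qed.

(* [(y0, z0)] minimizes [|t + y - z|] over [K * B]; the conclusion is the
   first-order optimality condition. *)
Lemma nearest_points t K B (b : R) :
  closed K -> closed B -> convex_set K -> convex_set B -> K 0 -> B 0 ->
  (forall z, B z -> forall i, `|z 0 i| <= b) ->
  exists y0 z0, [/\ K y0, B z0 & forall y z, K y -> B z ->
    dotv (t + y0 - z0) (y0 - z0) <= dotv (t + y0 - z0) (y - z)].
Proof.
move=> Kcl Bcl Kcvx Bcvx K0 B0 Bb.
pose f (w : 'rV[R]_N * 'rV[R]_N) := dotv (t + w.1 - w.2) (t + w.1 - w.2).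
pose box r := [set v : 'rV[R]_N | forall i, `|v 0 i| <= r].
(* [K] may be unbounded. Since $|y_i| \le |(t+y-z)_i| + |t_i| + |z_i|$, any pair with value at most
   $f(0,0) = |t|^2$ has its [y] in the box of this radius, so minimizing over the box suffices. *)
pose r := dotv t t + 1 + \big[Num.max/0]_i `|t 0 i| + b.
have tle i : `|t 0 i| <= \big[Num.max/0]_i `|t 0 i|.
  exact: (le_bigmax _ (fun i => `|t 0 i|)).
have Kco : compact (box r `&` K).
  by apply: compact_closedI => //; exact: coordinate_box_compact.
have Bco : compact B.
  by apply: subclosed_compact Bcl (@coordinate_box_compact b) _ => z /Bb.
have box0 : box r 0.
  move=> i; rewrite mxE normr0.
  have := Bb 0 B0 i; rewrite mxE normr0 /r => b0.
  have := le_trans (normr_ge0 _) (tle i).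
  have := dotvv_ge0 t; lra.
have gcont i : continuous (fun w : 'rV[R]_N * 'rV[R]_N => (t + w.1 - w.2) 0 i).
  move=> w; apply: (@continuous_comp _ _ _
    (fun w : 'rV[R]_N * 'rV[R]_N => t + w.1 - w.2) (fun v => v 0 i));
    last exact: coord_continuous.
  by apply: cvgB; [apply: cvgD; [exact: cvg_cst|exact: cvg_fst]|exact: cvg_snd].
have fcont : continuous f.
  apply: continuous_big; first exact: add_continuous.
  by move=> i _ w; apply: cvgM; exact: gcont.
have KB0 : ((box r `&` K) `*` B) !=set0 by exists (0, 0).
have [[y0 z0]] := compact_EVT_min KB0 (compact_setX Kco Bco)
  (continuous_subspaceT fcont).
rewrite inE => -[[/= _ Ky0] Bz0] minf.
have {}minf y z : K y -> B z -> f (y0, z0) <= f (y, z).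
  move=> Ky Bz; have [yr|] := pselect (box r y).
    by apply: minf; rewrite inE.
  rewrite leNgt => nyr; apply/negP => ltf; apply: nyr => i.
  have : f (y0, z0) <= f (0, 0) by apply: minf; rewrite inE.
  rewrite {2}/f /= addr0 subr0 => le0.
  have := norm_le_dotvv (t + y - z) i; rewrite -/(f (y, z)) !mxE.
  have := Bb z Bz i; have := tle i.
  rewrite /r; move: (\big[Num.max/0]_i _) => m.
  rewrite !ler_norml; lra.
exists y0, z0; split => // y z Ky Bz.
(* Moving [y0] towards [y] and [z0] towards [z] with the same [s] displaces $t+y_0-z_0$ by
   $s((y-z)-(y_0-z_0))$. *)
rewrite -subr_ge0 -dotvBr; apply: first_order_dotv => s s01.
have := minf _ _ (Kcvx _ _ _ Ky0 Ky s01) (Bcvx _ _ _ Bz0 Bz s01).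
rewrite /f /=; congr (_ <= dotv _ _);
  by apply/rowP => i; rewrite !mxE; ring.
Qed.

End NearestPoint.

(** * Complex matrices, beginning with real parts and moduli of scalars *)

Section ComplexMatrices.
Variables (R : realType) (n : nat).
Implicit Types (A B T Y Z D : 'M[R[i]]_n) (x : 'cV[R[i]]_n).

Local Notation N := (n * n + n * n)%N.
Local Notation Re := (@complex.Re R).
Local Notation Im := (@complex.Im R).
Local Notation conj := (@conjc R).
Local Notation psdc := (psd (n := n) conj).
Local Notation norm11c := (norm11 (n := n) Re).
Local Notation normooc := (normoo (n := n) Re).
Local Notation modulus z := (Re `|z|).

(** The norm on [R[i]] is itself [R[i]]-valued; this equation transfers its laws to the real number
    [modulus z]. *)
Lemma modulusE (z : R[i]) : `|z| = (modulus z)%:C%C.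
Proof. by rewrite normc_def. Qed.

Lemma modulus_ge0 (z : R[i]) : 0 <= modulus z.
Proof. by rewrite -ler0c -modulusE. Qed.

Lemma modulusD (y z : R[i]) : modulus (y + z) <= modulus y + modulus z.
Proof. by rewrite -lecR rmorphD /= -!modulusE ler_normD. Qed.

Lemma modulusM (y z : R[i]) : modulus (y * z) = modulus y * modulus z.
Proof. by apply: complexI; rewrite rmorphM /= -!modulusE normrM. Qed.

Lemma modulus_real (s : R) : modulus s%:C%C = `|s|.
Proof. by rewrite normc_def /= expr0n /= addr0 sqrtr_sqr. Qed.

(** Squaring leaves a polynomial condition on the real coordinates, from which closedness of the
    max-norm ball is read off. *)
Lemma modulus_le (z : R[i]) (p : R) : 0 <= p ->
  (modulus z <= p) = (Re z ^+ 2 + Im z ^+ 2 <= p ^+ 2).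
Proof.
move=> p0; rewrite normc_def /= -{1}(ger0_norm p0) -sqrtr_sqr ler_sqrt //.
exact: sqr_ge0.
Qed.

Lemma norm_Re_le (z : R[i]) : `|Re z| <= modulus z.
Proof. by rewrite -lecR -modulusE normc_ge_Re. Qed.

Lemma norm_Im_le (z : R[i]) : `|Im z| <= modulus z.
Proof.
by rewrite normc_def /= -sqrtr_sqr ler_wsqrtr // lerDr sqr_ge0.
Qed.

Lemma ReD (y z : R[i]) : Re (y + z) = Re y + Re z.
Proof. by case: y => ? ?; case: z. Qed.

Lemma Re_sum (I : Type) (r : seq I) (P : pred I) (F : I -> R[i]) :
  Re (\sum_(k <- r | P k) F k) = \sum_(k <- r | P k) Re (F k).
Proof. exact: (big_morph Re ReD). Qed.

Lemma ReMr (s : R) (z : R[i]) : Re (s%:C%C * z) = s * Re z.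
Proof. by case: z => a b /=; rewrite mul0r subr0. Qed.

(** * Self-adjoint and positive semidefinite complex matrices *)

Lemma selfadjointP A : selfadjoint conj A <-> forall k l, A k l = conj (A l k).
Proof.
split=> [/is_hermitianmxP AE k l|AE].
  by rewrite {1}AE expr0 scale1r !mxE.
by apply/is_hermitianmxP/matrixP => k l; rewrite expr0 scale1r !mxE.
Qed.

Lemma selfadjointD A B : selfadjoint conj A -> selfadjoint conj B ->
  selfadjoint conj (A + B).
Proof.
move=> /selfadjointP AE /selfadjointP BE; apply/selfadjointP => k l.
by rewrite !mxE rmorphD /= -AE -BE.
Qed.

Lemma selfadjointZ (s : R) A :
  selfadjoint conj A -> selfadjoint conj (s%:C%C *: A).
Proof.
move=> /selfadjointP AE; apply/selfadjointP => k l.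
by rewrite !mxE AE rmorphM; congr (_ * _); rewrite /= oppr0.
Qed.

Lemma quadform_entries A x :
  (map_mx conj x^T *m A *m x) 0 0 =
  \sum_k \sum_l conj (x k 0) * A k l * x l 0.
Proof.
rewrite mxE exchange_big; apply: eq_bigr => l _.
by rewrite mxE mulr_suml; apply: eq_bigr => k _; rewrite !mxE.
Qed.

(** Conjugating the double sum and exchanging its indices gives it back, so it is real. *)
Lemma Im_quadform A x : selfadjoint conj A ->
  Im ((map_mx conj x^T *m A *m x) 0 0) = 0.
Proof.
move=> /selfadjointP AE; rewrite quadform_entries.
set q := \sum_k _; suff : conj q = q.
  by case: q => a b [] bb /=; lra.
rewrite /q rmorph_sum exchange_big; apply: eq_bigr => k _.
rewrite rmorph_sum; apply: eq_bigr => l _.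
by rewrite !rmorphM /= conjcK -AE mulrC mulrA mulrAC.
Qed.

(** The order of [R[i]] also requires a zero imaginary part, which self-adjointness supplies; one
    real inequality per vector remains. *)
Lemma psdcP A : psdc A <-> selfadjoint conj A /\
  forall x, 0 <= Re ((map_mx conj x^T *m A *m x) 0 0).
Proof.
split=> -[Asa A0]; split => // x.
  by have := A0 x; rewrite lecE => /andP[].
by rewrite lecE Im_quadform // eqxx A0.
Qed.

Lemma psdc0 : psdc 0.
Proof.
split=> [|x]; first by apply/selfadjointP => k l; rewrite !mxE conjc0.
by rewrite mulmx0 mul0mx mxE.
Qed.

Lemma psdcD A B : psdc A -> psdc B -> psdc (A + B).
Proof.
move=> [Asa A0] [Bsa B0]; split=> [|x]; first exact: selfadjointD.
by rewrite mulmxDr mulmxDl mxE addr_ge0.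
Qed.

Lemma psdcZ (s : R) A : 0 <= s -> psdc A -> psdc (s%:C%C *: A).
Proof.
move=> s0 [Asa A0]; split=> [|x]; first exact: selfadjointZ.
by rewrite -scalemxAr -scalemxAl mxE mulr_ge0 ?ler0c.
Qed.

(** The form at [y] is $z\bar z$ with $z = y^H x$. *)
Lemma psdc_outer x : psdc (x *m map_mx conj x^T).
Proof.
split=> [|y].
  by apply/selfadjointP => k l;
    rewrite !mxE !big_ord1 !mxE rmorphM /= conjcK mulrC.
rewrite mulmxA -mulmxA mxE big_ord1.
suff -> : (map_mx conj x^T *m y) 0 0 = conj ((map_mx conj y^T *m x) 0 0).
  exact: mulcJ_ge0.
rewrite !mxE rmorph_sum; apply: eq_bigr => i _.
by rewrite !mxE rmorphM /= conjcK mulrC.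
Qed.

(** This entry is the quadratic form of [A] at the conjugate of row [i] of [Q]. *)
Lemma psdc_congr_diag m (Q : 'M[R[i]]_(m, n)) A i : psdc A ->
  0 <= (Q *m A *m map_mx conj Q^T) i i.
Proof.
move=> [_ A0]; have := A0 (\col_k conj (Q i k)).
congr (_ <= _); rewrite quadform_entries mxE exchange_big /=.
apply: eq_bigr => l _; rewrite !mxE mulr_suml; apply: eq_bigr => k _.
by rewrite !mxE conjcK.
Qed.

(* With [A = P^-1 diag(d) P], the trace is [\sum_i (P Y P^-1)_ii d_i]. *)
Lemma psdc_trace_ge0 Y A : psdc Y -> psdc A -> 0 <= \tr (Y *m A).
Proof.
move=> Ypsd Apsd.
have Aherm : A \is hermsymmx by case: Apsd.
have /orthomx_spectralP AE := hermitian_normalmx Aherm.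
set P := spectralmx A in AE; set d := spectral_diag A in AE.
have Pu : P \is unitarymx := spectral_unitarymx A.
have PV : invmx P = map_mx conj P^T := invmx_unitary Pu.
(* The eigenvalues thus become diagonal entries of $P A P^H$, so [psdc_congr_diag] gives their sign
   as well. *)
have dE : diag_mx d = P *m A *m map_mx conj P^T.
  by rewrite -PV [in RHS]AE !mulmxA mulmxV ?unitarymx_unit // mul1mx mulmxK
    ?unitarymx_unit.
have -> : \tr (Y *m A) = \tr (P *m Y *m map_mx conj P^T *m diag_mx d).
  by rewrite [in LHS]AE PV !mulmxA [LHS]mxtrace_mulC !mulmxA.
rewrite /mxtrace sumr_ge0 // => i _.
rewrite mxE (bigD1 i) //= big1 => [|j ji]; last first.
  by rewrite [X in _ * X]mxE (negbTE ji) mulr0n mulr0.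
rewrite addr0 mulr_ge0 ?psdc_congr_diag //.
by rewrite dE psdc_congr_diag.
Qed.

(** * Entrywise norms and weak duality *)

Lemma le_normooc A k l : modulus (A k l) <= normooc A.
Proof.
apply: le_trans (le_bigmax _ (fun k => \big[Num.max/0]_l modulus (A k l)) k).
exact: (le_bigmax _ (fun l => modulus (A k l))).
Qed.

Lemma normooc_le A (p : R) : 0 <= p -> (forall k l, modulus (A k l) <= p) ->
  normooc A <= p.
Proof.
by move=> p0 Ap; apply: bigmax_le => // k _; apply: bigmax_le.
Qed.

Lemma normooc_ge0 A : 0 <= normooc A.
Proof. exact: bigmax_ge_id. Qed.

Lemma norm11c_ge0 A : 0 <= norm11c A.
Proof.
by apply: sumr_ge0 => k _; apply: sumr_ge0 => l _; exact: modulus_ge0.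
Qed.

(** Hölder's inequality for the entrywise norms; the trace pairs [A k l] with [B l k], hence the
    exchange of sums. *)
Lemma trace_le_norms A B : Re (\tr (A *m B)) <= normooc A * norm11c B.
Proof.
rewrite /mxtrace Re_sum /norm11 exchange_big mulr_sumr /=.
apply: ler_sum => k _; rewrite mxE Re_sum mulr_sumr.
apply: ler_sum => l _; apply: le_trans (ler_norm _) _.
apply: le_trans (norm_Re_le _) _; rewrite modulusM.
by rewrite ler_wpM2r ?le_normooc ?modulus_ge0.
Qed.

Local Notation values T :=
  [set Re (\tr (T *m A)) | A in [set A | psdc A /\ norm11c A <= 1]].

Lemma norm11c0 : norm11c 0 = 0.
Proof.
by rewrite /norm11 big1 // => k _; rewrite big1 // => l _; rewrite mxE normr0.
Qed.

Lemma values0 T : values T 0.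
Proof.
exists 0; last by rewrite mulmx0 mxtrace0.
by split; [exact: psdc0|rewrite norm11c0 ler01].
Qed.

(** Weak duality: adding $\mathrm{tr}(YA) \ge 0$ to $\mathrm{tr}(TA)$ only increases it, and
    Hölder's inequality bounds the result. *)
Lemma values_ubound T Y : psdc Y -> ubound (values T) (normooc (T + Y)).
Proof.
move=> Ypsd _ [A [Apsd A1] <-].
apply: (@le_trans _ _ (Re (\tr ((T + Y) *m A)))).
  rewrite mulmxDl mxtraceD ReD lerDl.
  by have := psdc_trace_ge0 Ypsd Apsd; rewrite lecE => /andP[].
by apply: le_trans (trace_le_norms _ _) _; rewrite ler_piMr ?normooc_ge0.
Qed.

Lemma has_sup_values T : has_sup (values T).
Proof.
by split; [exists 0; exact: values0|exists (normooc (T + 0));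
  exact: values_ubound psdc0].
Qed.

Lemma pi_plusc_le T Y : psdc Y -> pi_plus conj Re T <= normooc (T + Y).
Proof.
by move=> Ypsd; apply: ge_sup (values_ubound Ypsd); exists 0; exact: values0.
Qed.

Lemma pi_plusc_ge0 T : 0 <= pi_plus conj Re T.
Proof. by apply: ub_le_sup (values0 T); case: (has_sup_values T). Qed.

Lemma norm11c_eq0 A : norm11c A = 0 -> A = 0.
Proof.
move=> /psumr_eq0P A0; apply/matrixP => k l; rewrite mxE.
have {A0}/psumr_eq0P A0 :=
  A0 (fun k _ => sumr_ge0 _ (fun l _ => modulus_ge0 _)) k isT.
have {A0} := A0 (fun l _ => modulus_ge0 _) l isT.
by move=> A0; apply/eqP; rewrite -normr_eq0 modulusE A0.
Qed.

(** By homogeneity: [A] divided by its norm competes in the supremum. A zero norm forces [A = 0] and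
    is treated apart. *)
Lemma trace_le_pi_plusc T A : psdc A ->
  Re (\tr (T *m A)) <= pi_plus conj Re T * norm11c A.
Proof.
move=> Apsd; have [A0|A0] := eqVneq (norm11c A) 0.
  by rewrite (norm11c_eq0 A0) mulmx0 mxtrace0 norm11c0 mulr0.
have {}A0 : 0 < norm11c A by rewrite lt_neqAle eq_sym A0 norm11c_ge0.
rewrite -ler_pdivrMr //; apply: ub_le_sup; first by case: (has_sup_values T).
exists ((norm11c A)^-1%:C%C *: A); last first.
  by rewrite -scalemxAr mxtraceZ ReMr mulrC.
split; first by apply: psdcZ => //; rewrite invr_ge0 ltW.
rewrite /norm11; under eq_bigr do under eq_bigr do
  rewrite mxE modulusM modulus_real ger0_norm ?invr_ge0 ?norm11c_ge0 //.
by under eq_bigr do rewrite -mulr_sumr; rewrite -mulr_sumr mulVf ?gt_eqF.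
Qed.

(* Real coordinates on the complex matrices: entrywise real parts, followed by
   entrywise imaginary parts. *)
Definition mx_of_coord (v : 'rV[R]_N) : 'M[R[i]]_n :=
  \matrix_(k, l) (v 0 (lshift _ (mxvec_index k l)) +i*
                  v 0 (rshift _ (mxvec_index k l)))%C.

Definition coord_of_mx A : 'rV[R]_N :=
  row_mx (mxvec (map_mx Re A)) (mxvec (map_mx Im A)).

Lemma coord_of_mxK A : mx_of_coord (coord_of_mx A) = A.
Proof.
apply/matrixP => k l; rewrite mxE row_mxEl row_mxEr !mxvecE !mxE.
by case: (A k l).
Qed.

Lemma mx_of_coordD u v : mx_of_coord (u + v) = mx_of_coord u + mx_of_coord v.
Proof. by apply/matrixP => k l; rewrite !mxE. Qed.

Lemma mx_of_coordZ (s : R) v : mx_of_coord (s *: v) = s%:C%C *: mx_of_coord v.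
Proof.
apply/matrixP => k l; rewrite !mxE; apply/eqP.
by rewrite eq_complex /= !mul0r subr0 addr0 !eqxx.
Qed.

Lemma mx_of_coordB u v : mx_of_coord (u - v) = mx_of_coord u - mx_of_coord v.
Proof.
rewrite mx_of_coordD -scaleN1r mx_of_coordZ; congr (_ + _).
by rewrite rmorphN rmorph1 scaleN1r.
Qed.

Lemma mx_of_coord0 : mx_of_coord 0 = 0.
Proof. by apply/matrixP => k l; rewrite !mxE. Qed.

(** Since $\Re(z\bar w) = \Re z\,\Re w + \Im z\,\Im w$, the Euclidean product of coordinates is the
    real part of the Hilbert-Schmidt product. *)
Lemma dotv_coord u v : dotv u v =
  Re (\sum_k \sum_l mx_of_coord u k l * conj (mx_of_coord v k l)).
Proof.
rewrite /dotv big_split_ord /= -big_split /=.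
rewrite (reindex _ (curry_mxvec_bij n n)) /=.
rewrite (eq_bigr (fun ij => Re (mx_of_coord u ij.1 ij.2 *
                                conj (mx_of_coord v ij.1 ij.2)))); last first.
  by move=> [k l] _ /=; rewrite ![mx_of_coord _ _ _]mxE /= mulrN opprK.
rewrite -(pair_bigA _ (fun k l => Re (mx_of_coord u k l *
                                      conj (mx_of_coord v k l)))) /=.
by rewrite Re_sum; apply: eq_bigr => k _; rewrite Re_sum.
Qed.

Lemma dotv_trace u v : selfadjoint conj (mx_of_coord v) ->
  dotv u v = Re (\tr (mx_of_coord u *m mx_of_coord v)).
Proof.
move=> /selfadjointP vE; rewrite dotv_coord; congr Re.
by apply: eq_bigr => k _; rewrite mxE; apply: eq_bigr => l _; rewrite -vE.
Qed.

(** By cyclicity, $x^H U x = \mathrm{tr}(U x x^H)$. For fixed [x] the form is thus linear in the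
    coordinates of [U], which serves both closedness of the cone and the optimality test along $x
    x^H$. *)
Lemma quadform_dotv u x : Re ((map_mx conj x^T *m mx_of_coord u *m x) 0 0) =
  dotv u (coord_of_mx (x *m map_mx conj x^T)).
Proof.
have [xsa _] := psdc_outer x.
by rewrite dotv_trace coord_of_mxK // mulmxA mxtrace_mulC mulmxA trace_mx11.
Qed.

(** * Closedness and convexity of the psd cone and of the max-norm ball, in coordinates *)

Lemma dotv_continuous (w : 'rV[R]_N) : continuous (fun v => dotv v w).
Proof.
apply: continuous_big; first exact: add_continuous.
by move=> i _ v; apply: continuousM;
  [exact: coord_continuous|exact: cst_continuous].
Qed.

Lemma closed_forall (T : topologicalType) (I : Type) (P : I -> set T) :
  (forall i, closed (P i)) -> closed [set x | forall i, P i x].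
Proof.
move=> Pcl; have := @closed_bigI T I setT P (fun i _ => Pcl i).
by congr closed; apply/seteqP; split => x Px i //; apply: Px.
Qed.

Lemma closed_selfadjoint : closed [set v | selfadjoint conj (mx_of_coord v)].
Proof.
(* In coordinates: a symmetric real part and an antisymmetric imaginary part. *)
have -> : [set v | selfadjoint conj (mx_of_coord v)] =
  [set v | forall kl : 'I_n * 'I_n,
    (v 0 (lshift _ (mxvec_index kl.1 kl.2)) -
     v 0 (lshift _ (mxvec_index kl.2 kl.1)) = 0) /\
    (v 0 (rshift _ (mxvec_index kl.1 kl.2)) +
     v 0 (rshift _ (mxvec_index kl.2 kl.1)) = 0)].
  apply/seteqP; split => v /=.
    move=> /selfadjointP vE [k l] /=; have := vE k l.
    by rewrite !mxE /= => -[-> ->]; rewrite subrr addNr.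
  move=> vE; apply/selfadjointP => k l; rewrite !mxE /=.
  by have [/= /subr0_eq -> /addr0_eq <-] := vE (k, l); rewrite opprK.
apply: closed_forall => kl; apply: closedI.
  apply: (@preimage_closed _ _ (fun v : 'rV[R]_N =>
    v 0 (lshift _ (mxvec_index kl.1 kl.2)) -
    v 0 (lshift _ (mxvec_index kl.2 kl.1))) [set 0]); last exact: closed_eq.
  by move=> v _; apply: continuousB; exact: coord_continuous.
apply: (@preimage_closed _ _ (fun v : 'rV[R]_N =>
  v 0 (rshift _ (mxvec_index kl.1 kl.2)) +
  v 0 (rshift _ (mxvec_index kl.2 kl.1))) [set 0]); last exact: closed_eq.
by move=> v _; apply: continuousD; exact: coord_continuous.
Qed.

(** The cone is the intersection of the self-adjoint subspace with one closed half-space for each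
    [x]. *)
Lemma closed_psdc : closed [set v | psdc (mx_of_coord v)].
Proof.
have -> : [set v | psdc (mx_of_coord v)] =
  [set v | selfadjoint conj (mx_of_coord v)] `&`
  [set v | forall x, 0 <= dotv v (coord_of_mx (x *m map_mx conj x^T))].
  apply/seteqP; split => v /=.
    by move=> /psdcP[vsa v0]; split => // x; rewrite -quadform_dotv.
  by move=> [vsa v0]; apply/psdcP; split => // x; rewrite quadform_dotv.
apply: closedI; first exact: closed_selfadjoint.
apply: closed_forall => x.
apply: (@preimage_closed _ _ (fun v => dotv v _) [set y | 0 <= y]);
  last exact: closed_ge.
by move=> v _; exact: dotv_continuous.
Qed.

(** For $p \ge 0$ this is the ball of radius [p] of [normoo]; bounding each entry separately lets
    closedness and convexity be checked entry by entry. *)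
Definition selfadjoint_ball (p : R) : set 'rV[R]_N :=
  [set v | selfadjoint conj (mx_of_coord v) /\
           forall k l, modulus (mx_of_coord v k l) <= p].

Lemma closed_selfadjoint_ball p : 0 <= p -> closed (selfadjoint_ball p).
Proof.
move=> p0; apply: closedI; first exact: closed_selfadjoint.
apply: closed_forall => k; apply: closed_forall => l.
suff : closed [set v : 'rV[R]_N |
    v 0 (lshift _ (mxvec_index k l)) ^+ 2 +
    v 0 (rshift _ (mxvec_index k l)) ^+ 2 <= p ^+ 2].
  by congr closed; apply/seteqP; split => v /=; rewrite modulus_le // !mxE.
apply: (@preimage_closed _ _ (fun v : 'rV[R]_N =>
  v 0 (lshift _ (mxvec_index k l)) ^+ 2 +
  v 0 (rshift _ (mxvec_index k l)) ^+ 2) [set y | y <= p ^+ 2]);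
  last exact: closed_le.
have sqr_cont i : continuous (fun v : 'rV[R]_N => v 0 i ^+ 2).
  by move=> v; apply: (@continuousM R 'rV[R]_N); exact: coord_continuous.
by move=> v _; exact: (@continuousD R _ _ _ _ v (sqr_cont _ v) (sqr_cont _ v)).
Qed.

Lemma selfadjoint_ball_coord_le p v i : selfadjoint_ball p v -> `|v 0 i| <= p.
Proof.
move=> [_ vp]; case: (split_ordP i) => j ->; case/mxvec_indexP: j => k l;
  apply: le_trans (vp k l); rewrite mxE.
- exact: le_trans (norm_Re_le _).
- exact: le_trans (norm_Im_le _).
Qed.

Lemma convex_psdc : convex_set [set v | psdc (mx_of_coord v)].
Proof.
move=> u v s /= upsd vpsd /andP[s0 s1].
have -> : u + s *: (v - u) = (1 - s) *: u + s *: v.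
  by rewrite scalerBr scalerBl scale1r addrA addrAC.
rewrite /= mx_of_coordD !mx_of_coordZ.
by apply: psdcD; [apply: psdcZ upsd; rewrite subr_ge0|exact: psdcZ s0 vpsd].
Qed.

Lemma modulus_convex (y z : R[i]) (p s : R) :
  modulus y <= p -> modulus z <= p -> 0 <= s -> s <= 1 ->
  modulus ((1 - s)%:C%C * y + s%:C%C * z) <= p.
Proof.
move=> yp zp s0 s1; apply: le_trans (modulusD _ _) _.
rewrite !modulusM !modulus_real (ger0_norm s0) ger0_norm ?subr_ge0 //.
by move: (modulus y) (modulus z) yp zp => a b ap bp; nra.
Qed.

Lemma convex_selfadjoint_ball p : convex_set (selfadjoint_ball p).
Proof.
move=> u v s [usa up] [vsa vp] /andP[s0 s1].
have -> : u + s *: (v - u) = (1 - s) *: u + s *: v.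
  by rewrite scalerBr scalerBl scale1r addrA addrAC.
rewrite /selfadjoint_ball /= mx_of_coordD !mx_of_coordZ; split.
  by apply: selfadjointD; apply: selfadjointZ.
move=> k l; have := modulus_convex (up k l) (vp k l) s0 s1.
suff -> : ((1 - s)%:C%C *: mx_of_coord u + s%:C%C *: mx_of_coord v) k l =
  (1 - s)%:C%C * mx_of_coord u k l + s%:C%C * mx_of_coord v k l by [].
by rewrite mxE; congr (_ + _); rewrite mxE.
Qed.

(* The matrix of phases of [D], where [0 / 0 = 0]: the extremal point of the
   max-norm ball dual to [D]. *)
Definition phase D : 'M[R[i]]_n := \matrix_(k, l) (D k l / `|D k l|).

Lemma conj_norm (z : R[i]) : conj `|z| = `|z|.
Proof. by rewrite modulusE; exact: conjc_real. Qed.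

Lemma phase_ball p D : 0 <= p -> selfadjoint conj D ->
  selfadjoint_ball p (coord_of_mx (p%:C%C *: phase D)).
Proof.
move=> p0 Dsa; split=> [|k l]; rewrite coord_of_mxK.
  apply: selfadjointZ; apply/selfadjointP => k l; move/selfadjointP: Dsa => DE.
  rewrite !mxE [D k l]DE normcJ rmorphM fmorphV; congr (_ * _^-1).
  exact/esym/conj_norm.
rewrite !mxE modulusM modulus_real ger0_norm // ler_piMr //.
(* A phase has modulus 1, or 0 where the entry of [D] vanishes. *)
have [->|D0] := eqVneq (D k l) 0; first by rewrite mul0r normr0 ler01.
by rewrite normf_div normr_id divff ?normr_eq0.
Qed.

(** $z\bar z/|z| = |z|^2/|z| = |z|$, also at $z = 0$, where the quotient is 0 by convention. *)
Lemma mul_conj_phase (p : R) (z : R[i]) :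
  z * conj (p%:C%C * (z / `|z|)) = (p * modulus z)%:C%C.
Proof.
have -> : conj (p%:C%C * (z / `|z|)) = p%:C%C * (conj z / `|z|).
  rewrite !rmorphM fmorphV; congr (_ * (_ * _^-1)); last exact: conj_norm.
  exact: conjc_real.
rewrite mulrCA [RHS]rmorphM; congr (_ * _).
transitivity `|z|; last exact: modulusE.
rewrite mulrA -sqr_normc; have [->|z0] := eqVneq z 0.
  by rewrite normr0 invr0 mulr0.
by rewrite expr2 mulfK ?normr_eq0.
Qed.

(** The case of equality in Hölder's inequality. *)
Lemma dotv_phase p d :
  dotv d (coord_of_mx (p%:C%C *: phase (mx_of_coord d))) =
  p * norm11c (mx_of_coord d).
Proof.
rewrite dotv_coord coord_of_mxK Re_sum mulr_sumr; apply: eq_bigr => k _.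
rewrite Re_sum mulr_sumr; apply: eq_bigr => l _.
by move: (mx_of_coord d) => D; rewrite mxE [phase D k l]mxE mul_conj_phase.
Qed.

(** * Strong duality over the complex numbers *)

Lemma pi_plusc_attained T : selfadjoint conj T ->
  exists2 Y, psdc Y & normooc (T + Y) <= pi_plus conj Re T.
Proof.
move=> Tsa; have p0 := pi_plusc_ge0 T; set p := pi_plus _ _ _ in p0 *.
pose t := coord_of_mx T.
have [||y0 [z0 []]] := nearest_points t closed_psdc
  (closed_selfadjoint_ball p0) convex_psdc (@convex_selfadjoint_ball p) _ _
  (fun z zB i => selfadjoint_ball_coord_le i zB).
- by rewrite /= mx_of_coord0; exact: psdc0.
- split=> [|k l]; rewrite mx_of_coord0; last by rewrite mxE normr0.
  by case: psdc0.
rewrite /= => y0psd [z0sa z0p]; set d := t + y0 - z0 => dmin.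
pose D := mx_of_coord d.
have DE : D = T + mx_of_coord y0 - mx_of_coord z0.
  by rewrite /D mx_of_coordB mx_of_coordD coord_of_mxK.
have z0B : selfadjoint_ball p z0 by [].
have Dsa : selfadjoint conj D.
  rewrite DE -scaleN1r.
  have -> : -1 = (-1)%:C%C :> R[i] by rewrite rmorphN rmorph1.
  apply: selfadjointD; last exact: selfadjointZ.
  by apply: selfadjointD; [exact: Tsa|case: y0psd].
have Dpsd : psdc D.
  apply/psdcP; split=> // x; rewrite quadform_dotv.
  (* The terms in [y0] and [z0] cancel and leave $0 \le \langle d, x x^H\rangle$. *)
  have := dmin (y0 + coord_of_mx (x *m map_mx conj x^T)) z0 _ z0B.
  rewrite mx_of_coordD coord_of_mxK => /(_ (psdcD y0psd (psdc_outer x))).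
  by rewrite !dotvBr dotvDr; lra.
have y0z0 : dotv d (y0 - z0) <= - (p * norm11c D).
  have := dmin 0 _ _ (phase_ball p0 Dsa).
  rewrite mx_of_coord0 => /(_ psdc0).
  rewrite [X in _ <= X]dotvBr dotv_phase.
  by have := dotvZr d 0 0; rewrite scale0r; lra.
have d0 : d = 0.
  apply: dotvv_eq0; rewrite {2}/d -addrA dotvDr.
  have -> : dotv d t = Re (\tr (T *m D)).
    by rewrite dotv_trace coord_of_mxK // mxtrace_mulC.
  by have := trace_le_pi_plusc T Dpsd; rewrite -/p; lra.
exists (mx_of_coord y0) => //.
have -> : T + mx_of_coord y0 = mx_of_coord z0.
  by apply/subr0_eq; rewrite -DE /D d0 mx_of_coord0.
exact: normooc_le.
Qed.

Lemma pi_plusc_is_minimum T : selfadjoint conj T ->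
  is_minimum [set normooc (T + Y) | Y in psdc] (pi_plus conj Re T).
Proof.
move=> Tsa; split=> [|_ [Y Ypsd <-]]; last exact: pi_plusc_le.
have [Y Ypsd le] := pi_plusc_attained Tsa; exists Y => //.
by apply/eqP; rewrite eq_le le pi_plusc_le.
Qed.

End ComplexMatrices.

(** * Reduction of the real case to the complex one *)

Section RealMatrices.
Variables (R : realType) (n : nat).
Implicit Types (A T Y : 'M[R]_n) (C : 'M[R[i]]_n).

Local Notation Re := (@complex.Re R).
Local Notation Im := (@complex.Im R).
Local Notation conj := (@conjc R).
Local Notation psdr := (psd (n := n) (@idfun R)).
Local Notation psdc := (psd (n := n) conj).
Local Notation toC := (map_mx (real_complex R)).

Lemma selfadjointrP A : selfadjoint idfun A <-> forall k l, A k l = A l k.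
Proof.
split=> [/is_hermitianmxP AE k l|AE].
  by rewrite {1}AE expr0 scale1r !mxE.
by apply/is_hermitianmxP/matrixP => k l; rewrite expr0 scale1r !mxE.
Qed.

Lemma quadformr_entries A (x : 'cV[R]_n) :
  (map_mx idfun x^T *m A *m x) 0 0 = \sum_k \sum_l x k 0 * A k l * x l 0.
Proof.
rewrite mxE exchange_big; apply: eq_bigr => l _.
by rewrite mxE mulr_suml; apply: eq_bigr => k _; rewrite !mxE.
Qed.

Lemma map_Re_toC A : map_mx Re (toC A) = A.
Proof. by apply/matrixP => k l; rewrite !mxE. Qed.

Lemma selfadjoint_toC A : selfadjoint idfun A -> selfadjoint conj (toC A).
Proof.
move=> /selfadjointrP AE; apply/selfadjointP => k l.
by rewrite !mxE AE; exact/esym/conjc_real.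
Qed.

(* The quadratic form of [A] at [u + i v] is the sum of those at [u] and [v]. *)
Lemma psd_toC A : psdr A -> psdc (toC A).
Proof.
move=> [Asa A0]; apply/psdcP; split=> [|x]; first exact: selfadjoint_toC.
have := addr_ge0 (A0 (map_mx Re x)) (A0 (map_mx Im x)).
congr (_ <= _); rewrite quadform_entries !quadformr_entries Re_sum -big_split.
apply: eq_bigr => k _; rewrite Re_sum -big_split; apply: eq_bigr => l _.
rewrite !mxE; case: (x k 0) (x l 0) => a b [c d] /=; ring.
Qed.

(** At a real vector, the form of [map_mx Re C] is the real part of the form of [C]. *)
Lemma psd_map_Re C : psdc C -> psdr (map_mx Re C).
Proof.
move=> [/selfadjointP CE C0]; split=> [|x].
  by apply/selfadjointrP => k l; rewrite !mxE CE; case: (C l k).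
have := C0 (map_mx (real_complex R) x); rewrite lecE => /andP[_].
congr (_ <= _); rewrite quadform_entries quadformr_entries Re_sum.
apply: eq_bigr => k _; rewrite Re_sum; apply: eq_bigr => l _.
rewrite !mxE; case: (C k l) => a b /=; ring.
Qed.

Lemma norm11_toC A : norm11 Re (toC A) = norm11 idfun A.
Proof.
apply: eq_bigr => k _; apply: eq_bigr => l _.
by rewrite mxE modulus_real.
Qed.

Lemma normoo_toC A : normoo Re (toC A) = normoo idfun A.
Proof.
apply: eq_bigr => k _; apply: eq_bigr => l _.
by rewrite mxE modulus_real.
Qed.

Lemma norm11_map_Re C : norm11 idfun (map_mx Re C) <= norm11 Re C.
Proof.
by apply: ler_sum => k _; apply: ler_sum => l _; rewrite mxE norm_Re_le.
Qed.

Lemma normoo_map_Re C : normoo idfun (map_mx Re C) <= normoo Re C.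
Proof.
rewrite -normoo_toC; apply: normooc_le => [|k l]; first exact: normooc_ge0.
by rewrite !mxE modulus_real (le_trans (norm_Re_le _)) ?le_normooc.
Qed.

Lemma trace_toC_Re T C : Re (\tr (toC T *m C)) = \tr (T *m map_mx Re C).
Proof.
rewrite Re_sum; apply: eq_bigr => k _; rewrite !mxE Re_sum.
by apply: eq_bigr => l _; rewrite !mxE ReMr.
Qed.

(** Both suprema range over the same set of values: [map_mx Re] and [toC] carry feasible matrices to
    feasible ones and keep the trace against the real matrix [T]. *)
Lemma pi_plus_toC T : pi_plus conj Re (toC T) = pi_plus idfun idfun T.
Proof.
congr sup; apply/seteqP; split=> _ [A [Apsd A1] <-].
  exists (map_mx Re A); last by rewrite trace_toC_Re.
  by split; [exact: psd_map_Re|exact: le_trans (norm11_map_Re A) A1].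
exists (toC A); last by rewrite trace_toC_Re map_Re_toC.
by split; [exact: psd_toC|rewrite norm11_toC].
Qed.

(** The lower bound comes from embedding a real [Y] into the complex matrices, attainment from the
    real part of a complex minimizer. *)
Lemma pi_plusr_is_minimum T : selfadjoint idfun T ->
  is_minimum [set normoo idfun (T + Y) | Y in psdr] (pi_plus idfun idfun T).
Proof.
move=> Tsa; rewrite -pi_plus_toC.
have lb Y : psdr Y -> pi_plus conj Re (toC T) <= normoo idfun (T + Y).
  move=> /psd_toC Ypsd; rewrite -normoo_toC map_mxD.
  exact: pi_plusc_le.
split=> [|_ [Y Ypsd <-]]; last exact: lb.
have [Y /psd_map_Re Ypsd le] := pi_plusc_attained (selfadjoint_toC Tsa).
exists (map_mx Re Y) => //; apply/eqP; rewrite eq_le lb // andbT.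
apply: le_trans le; apply: le_trans (normoo_map_Re _).
suff -> : map_mx Re (toC T + Y) = T + map_mx Re Y by [].
by apply/matrixP => k l; rewrite !mxE ReD.
Qed.

End RealMatrices.

Theorem theorem4p3 (R : realType) (n : nat) :
  (forall T : 'M[R]_n, selfadjoint idfun T ->
     is_minimum [set normoo idfun (T + Y) | Y in psd idfun]
                (pi_plus idfun idfun T))
  /\
  (forall T : 'M[R[i]]_n, selfadjoint (@conjc R) T ->
     is_minimum [set normoo (@complex.Re R) (T + Y) | Y in psd (@conjc R)]
                (pi_plus (@conjc R) (@complex.Re R) T)).
Proof.
by split=> T; [exact: pi_plusr_is_minimum|exact: pi_plusc_is_minimum].
Qed.
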